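(* Consider the static map $\varphi(x)=\varphi^*+\frac{\varphi''}{2}(x-x^* )^2$ with $x^*,\varphi^*\in\mathbb R$ and $\varphi''>0$, and the extremum seeking iteration $$\hat x_{k+1}=\hat x_k-\epsilon\sin(v_{k+1})\,y_{k+1},\qquad y_{k+1}=\varphi(x_k)+W_{k+1},\qquad x_k=\hat x_k+a\sin(v_{k+1}),$$ with $a>0$, $\epsilon\in(0,\epsilon_0)$, where $\{v_k\}$ is an i.i.d. sequence of $N(0,\sigma^2)$ random variables and $\{W_k\}$ is a real-valued ergodic sequence bounded by a constant $M$ (i.e. $|W_k|\le M$), independent of $\{v_k\}$. Let $\tilde x_k=\hat x_k-x^*$. Then there exist constants $c_\epsilon>0$ and $0<\gamma_\epsilon<1$ such that for every initial condition $\tilde x_0\in\mathbb R$ and every $\delta>0$, $$\lim_{\epsilon\to0}\inf\{k\in\mathbb N:|\tilde x_k|>c_\epsilon|\tilde x_0|\gamma_\epsilon^k+\delta\}=+\infty\ \text{ a.s.},$$ and for every $N\in\mathbb N$, $$\lim_{\epsilon\to0}P\{|\tilde x_k|\le c_\epsilon|\tilde x_0|\gamma_\epsilon^k+\delta\ \ \forall k=0,1,\dots,[N/\epsilon]\}=1,$$ where $[s]$ is the largest integer not exceeding $s$.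
   Context: All random variables are defined on a complete probability space $(\Omega,\mathcal F,P)$; $\hat x_0$ is deterministic. An ergodic sequence $\{W_k\}$ with invariant distribution $\nu$ is one whose time averages $\frac1{N+1}\sum_{k=0}^N g(W_{k+1})$ converge almost surely to $\int g\,d\nu$ for bounded measurable $g$. *)

(* Defs.v *)
From HB Require Import structures.
From mathcomp Require Import all_boot all_order all_algebra.
From mathcomp Require Import all_classical all_reals all_analysis.
From mathcomp Require Export normal_distribution.
Set Implicit Arguments. Unset Strict Implicit. Unset Printing Implicit Defensive.
Import Order.TTheory GRing.Theory Num.Theory.
Import numFieldTopology.Exports.
Local Open Scope classical_set_scope.
Local Open Scope ring_scope.

Section defs.
Context {d : measure_display} {T : measurableType d} {R : realType}.

Definition mutually_independent_seq (P : probability T R) (X : nat -> T -> R) :=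
  forall (n : nat) (A : nat -> set R), (forall i, measurable (A i)) ->
    P (\bigcap_(i in [set i | (i < n)%N]) (X i @^-1` A i))
    = (\prod_(i < n) P (X i @^-1` A i))%E.

(** identically distributed N(m, s^2) (s = standard deviation) *)
Definition normal_distributed_seq (P : probability T R) (X : nat -> T -> R) (m s : R) :=
  forall (k : nat) (A : set R), measurable A ->
    P (X k @^-1` A) = normal_prob m s A.

Definition iid_normal (P : probability T R) (X : nat -> T -> R) (sigma : R) :=
  (forall k, measurable_fun setT (X k)) /\
  mutually_independent_seq P X /\ normal_distributed_seq P X 0 sigma.

(** The sequences X and Y are independent (independence of the sigma-algebras
    they generate, stated on finite-dimensional cylinder events, which form a
    pi-system generating these sigma-algebras). *)
Definition independent_seqs (P : probability T R) (X Y : nat -> T -> R) :=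
  forall (n : nat) (A B : nat -> set R),
    (forall i, measurable (A i)) -> (forall i, measurable (B i)) ->
    P (\bigcap_(i in [set i | (i < n)%N]) (X i @^-1` A i)
       `&` \bigcap_(i in [set i | (i < n)%N]) (Y i @^-1` B i))
    = (P (\bigcap_(i in [set i | (i < n)%N]) (X i @^-1` A i))
       * P (\bigcap_(i in [set i | (i < n)%N]) (Y i @^-1` B i)))%E.

Definition ergodic_seq (P : probability T R) (W : nat -> T -> R)
    (nu : probability R R) :=
  forall g : R -> R, measurable_fun setT g ->
    (exists C : R, forall x, `|g x| <= C) ->
    {ae P, forall w, (fun N : nat =>
        ((N.+1%:R)^-1 * \sum_(k < N.+1) g (W k.+1 w))%:E) @ \oo
        --> (\int[nu]_x (g x)%:E)%E}.

End defs.

Definition quad_map {R : realType} (phistar phi2 xstar : R) (x : R) : R :=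
  phistar + phi2 / 2 * (x - xstar) ^+ 2.

Fixpoint es_xhat {T : Type} {R : realType} (phi : R -> R) (a eps xhat0 : R)
    (v W : nat -> T -> R) (w : T) (k : nat) : R :=
  match k with
  | 0 => xhat0
  | k'.+1 =>
      let xh := es_xhat phi a eps xhat0 v W w k' in
      let xk := xh + a * sin (v k'.+1 w) in
      let y := phi xk + W k'.+1 w in
      xh - eps * sin (v k'.+1 w) * y
  end.

(** inf { k in N : P k }, in the extended reals (inf of the empty set = +oo) *)
Definition first_index {R : realType} (Pk : nat -> Prop) : \bar R :=
  ereal_inf [set ((k%:R : R)%:E) | k in [set k : nat | Pk k]].

(* Main.v *)
Require Import Defs.
From HB Require Import structures.
From mathcomp Require Import all_boot all_order all_algebra.
From mathcomp Require Import all_classical all_reals all_analysis.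
From mathcomp Require Import normal_distribution.
From mathcomp Require Import measurable_realfun ring lra.
Set Implicit Arguments. Unset Strict Implicit. Unset Printing Implicit Defensive.
Import Order.TTheory GRing.Theory Num.Theory.
Import numFieldTopology.Exports.
Local Open Scope classical_set_scope.
Local Open Scope ring_scope.

(** Since [sin] is odd and the probes are centred Gaussians, averaging the
    recursion over the next probe gives the linear contraction
    [x |-> (1 - eps * phi2 * a * m2) x], where [m2] is the mean of [sin^2]: the
    unknown [phistar], the noise [W] and the quadratic term only multiply odd
    powers of the sine.  Hence, with [rho := 1 - eps * phi2 * a * m2], the error
    [e k := (xhat k - xstar) - rho ^ k (xhat 0 - xstar)] satisfies
    [e k.+1 = rho * e k + eps * (mean-zero noise)], the noise being bounded by a
    constant [K] as long as [|e k| < delta].  The expected square of [e], frozen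
    at [delta ^ 2] on leaving [|e| < delta], grows by at most [(eps K) ^ 2] per
    step, so the exit probability within [N / eps] steps is
    [O(N K^2 eps / delta^2)].  This gives the second limit with [c = 1] and
    [gamma = rho].  The almost sure limit is pathwise: for fixed [k] the error
    [e k] tends to [0] with [eps]. *)

(** * Independence and partial averaging *)

Lemma integral_probability_cst (d : measure_display) (T : measurableType d)
    (R : realType) (P : probability T R) (c : R) : (\int[P]_w c%:E = c%:E)%E.
Proof.
rewrite integral_cst// -[RHS]mule1; congr (_ * _)%E.
exact: probability_setT.
Qed.

(** Both sides are finite measures in [E]: [P] restricted to [B], and [P] scaled by [P B]. They
    agree on a pi-system containing the whole space, hence on the sigma-algebra it generates. *)
Lemma g_sigma_algebra_independent (d : measure_display) (T : measurableType d)
    (R : realType) (P : probability T R) (G : set (set T)) (B : set T) :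
  G `<=` measurable -> setI_closed G -> G setT -> measurable B ->
  (forall C, G C -> P (C `&` B) = (P C * P B)%E) ->
  forall E, <<s G >> E -> P (E `&` B) = (P E * P B)%E.
Proof.
move=> Gm GI GT mB GP E sE.
have PBfin : P B \is a fin_num by exact: fin_num_measure.
have r0 : 0 <= fine (P B) by exact: fine_ge0.
pose m1 := mrestr P mB.
pose m2 := mscale (NngNum r0) P.
have m2E A : m2 A = (P A * P B)%E by rewrite /m2/= /mscale/= fineK// muleC.
rewrite -m2E.
apply: (@g_sigma_algebra_measure_unique _ _ _ G Gm (fun=> setT) _ _ m1 m2) => //.
- by rewrite bigcup_const//; exists 0%N.
- by move=> C GC; exact: etrans (GP _ GC) (esym (m2E C)).
- by move=> _; rewrite /m1/= /mrestr setTI ltey_eq PBfin.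
Qed.

(* A random input independent of the state can be averaged first, with the
   state frozen: the law of (X, V) is a product, and Tonelli applies. *)
Lemma ge0_integral_independent (d dS dU : measure_display)
    (T : measurableType d) (S : measurableType dS) (U : measurableType dU)
    (R : realType) (P : probability T R) (X : T -> S) (V : T -> U)
    (nu : probability U R) (F : S * U -> \bar R) :
  measurable_fun setT X -> measurable_fun setT V ->
  (forall A B, measurable A -> measurable B ->
    P (X @^-1` A `&` V @^-1` B) = (P (X @^-1` A) * nu B)%E) ->
  measurable_fun setT F -> (forall z, 0 <= F z)%E ->
  (\int[P]_w F (X w, V w) = \int[P]_w \int[nu]_t F (X w, t))%E.
Proof.
move=> mX mV ind mF F0.
pose X' : {mfun T >-> S} := HB.pack X (isMeasurableFun.Build _ _ _ _ _ mX).
have mXV : measurable_fun setT (fun w => (X w, V w)).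
  exact: measurable_fun_pair.
pose XV : {mfun T >-> (S * U)%type} :=
  HB.pack (fun w => (X w, V w)) (isMeasurableFun.Build _ _ _ _ _ mXV).
transitivity (\int[distribution P XV]_z F z)%E.
  by rewrite ge0_integral_distribution.
transitivity (\int[distribution P X' \x nu]_z F z)%E.
  apply: eq_measure_integral => A mA _; apply/esym.
  exact: product_measure_unique.
rewrite fubini_tonelli1// ge0_integral_distribution//.
- exact: measurable_fun_fubini_tonelli_F.
- by move=> y; exact: integral_ge0.
Qed.

(** * Symmetry of the centred Gaussian law *)

(** Reflection preserves the length of half-open intervals, and these determine Lebesgue measure. *)
Lemma lebesgue_measure_oppr (R : realType) (A : set R) : measurable A ->
  lebesgue_measure (-%R @^-1` A) = lebesgue_measure A.
Proof.
move=> mA; apply/esym.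
have mN : measurable_fun setT (-%R : measurableTypeR R -> measurableTypeR R).
  exact: oppr_measurable.
pose N : {mfun measurableTypeR R >-> measurableTypeR R} :=
  HB.pack (-%R : R -> R) (isMeasurableFun.Build _ _ _ _ _ mN).
suff H X : ocitv X -> lebesgue_measure X = pushforward lebesgue_measure N X.
  exact: (@lebesgue_measure_unique _ (pushforward lebesgue_measure N) H).
move=> [[a b] _ <-] /=.
rewrite /pushforward/=.
have -> : -%R @^-1` `]a, b] = `[- b, - a[%classic.
  by apply/seteqP; split=> x/=; rewrite !in_itv/= ltrNr lerNl andbC.
rewrite !lebesgue_measure_itv/= !lte_fin ltrN2; case: ifPn => // _.
by rewrite !EFinN oppeK addeC.
Qed.

(** The centred Gaussian density is even, and Lebesgue measure is invariant under reflection. *)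
Lemma normal_prob_oppr (R : realType) (sigma : R) (A : set R) :
  sigma != 0 -> measurable A ->
  normal_prob 0 sigma (-%R @^-1` A) = normal_prob 0 sigma A.
Proof.
move=> s0 mA; apply/esym.
have mN : measurable_fun setT (-%R : measurableTypeR R -> measurableTypeR R).
  exact: oppr_measurable.
pose N : {mfun measurableTypeR R >-> measurableTypeR R} :=
  HB.pack (-%R : R -> R) (isMeasurableFun.Build _ _ _ _ _ mN).
rewrite /normal_prob.
transitivity (\int[pushforward lebesgue_measure N]_(x in A)
    (normal_pdf 0 sigma x)%:E)%E.
  apply: eq_measure_integral => B mB _; apply/esym.
  exact: lebesgue_measure_oppr.
rewrite ge0_integral_pushforward//.
- apply: eq_integral => x _ /=.
  by rewrite normal_pdfE// /normal_fun !subr0 sqrrN.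
- apply/measurable_EFinP; apply: measurable_funTS.
  exact: measurable_normal_pdf.
- by move=> y _; rewrite lee_fin normal_pdf_ge0.
Qed.

Lemma bounded_integrable_probability (d : measure_display)
    (T : measurableType d) (R : realType) (P : probability T R)
    (f : T -> R) (C : R) :
  measurable_fun setT f -> (forall t, `|f t| <= C) ->
  P.-integrable setT (EFin \o f).
Proof.
move=> mf fC; apply: measurable_bounded_integrable => //.
  exact: le_lt_trans (probability_le1 P measurableT) (ltry 1).
by exists C; split; rewrite ?num_real// => x Cx t _; exact: le_trans (ltW Cx).
Qed.

(** The change of variable [t |-> - t] preserves the law and negates the integrand, so the integral
    is its own opposite; boundedness of [f] makes it finite, hence zero. *)
Lemma integral_normal_prob_odd (R : realType) (sigma C : R)
    (f : measurableTypeR R -> R) :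
  sigma != 0 -> measurable_fun setT f -> (forall t, `|f t| <= C) ->
  (forall t, f (- t) = - f t) ->
  (\int[normal_prob 0 sigma]_t (f t)%:E = 0)%E.
Proof.
move=> s0 mf fC fodd.
have mN : measurable_fun setT (-%R : measurableTypeR R -> measurableTypeR R).
  exact: oppr_measurable.
pose N : {mfun measurableTypeR R >-> measurableTypeR R} :=
  HB.pack (-%R : R -> R) (isMeasurableFun.Build _ _ _ _ _ mN).
have intf : (normal_prob 0 sigma).-integrable setT (EFin \o f).
  exact: bounded_integrable_probability mf fC.
have intfN : (normal_prob 0 sigma).-integrable setT (EFin \o (f \o N)).
  apply: (@bounded_integrable_probability _ _ _ _ _ C) => [|t]; last exact: fC.
  exact: measurableT_comp.
have : (\int[normal_prob 0 sigma]_t (f t)%:E =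
        - \int[normal_prob 0 sigma]_t (f t)%:E)%E.
  transitivity (\int[pushforward (normal_prob 0 sigma) N]_t (f t)%:E)%E.
    apply: eq_measure_integral => A mA _; apply/esym.
    exact: normal_prob_oppr.
  rewrite integral_pushforward//=.
  - rewrite -integralN//=; last exact: integrable_add_def.
    by apply: eq_integral => x _ /=; rewrite fodd.
  exact/measurable_EFinP.
have : (\int[normal_prob 0 sigma]_t (f t)%:E)%E \is a fin_num.
  exact: integrable_fin_num.
case: (\int[_]_t _)%E => //= r _ [] rr; congr EFin; lra.
Qed.

(** * Moments of the sine of a Gaussian probe *)

Lemma measurable_sin (R : realType) : measurable_fun setT (@sin R : measurableTypeR R -> R).
Proof. exact: continuous_measurable_fun (@continuous_sin R). Qed.

Lemma normr_sin_le1 (R : realType) (t : R) : `|sin t| <= 1.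
Proof. by rewrite ler_norml sin_geN1 sin_le1. Qed.

Definition sin_sqr_mean (R : realType) (sigma : R) : R :=
  fine (\int[normal_prob 0 sigma]_t (sin t ^+ 2)%:E)%E.

Lemma normr_sin_exp_le1 (R : realType) (n : nat) (t : R) :
  `|sin t ^+ n| <= 1.
Proof. by rewrite normrX exprn_ile1 ?normr_sin_le1. Qed.

Lemma measurable_sin_exp (R : realType) (n : nat) :
  measurable_fun setT (fun t : measurableTypeR R => sin t ^+ n).
Proof. by apply: measurable_funX; exact: measurable_sin. Qed.

Lemma integrable_sin_exp (R : realType) (sigma : R) (n : nat) :
  (normal_prob 0 sigma).-integrable setT (fun t => (sin t ^+ n)%:E).
Proof.
exact: (@bounded_integrable_probability _ _ _ (normal_prob 0 sigma) _ 1
  (@measurable_sin_exp R n) (normr_sin_exp_le1 n)).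
Qed.

Lemma sin_sqr_meanE (R : realType) (sigma : R) :
  (\int[normal_prob 0 sigma]_t (sin t ^+ 2)%:E)%E = (sin_sqr_mean sigma)%:E.
Proof.
by rewrite fineK//; apply: integrable_fin_num => //; exact: integrable_sin_exp.
Qed.

(** This makes the averaged recursion a strict contraction. A zero mean would force [sin] to vanish
    almost surely, so []0, pi[] would be Gaussian-null; the density being positive, it would be
    Lebesgue-null, yet its length is [pi]. *)
Lemma sin_sqr_mean_gt0 (R : realType) (sigma : R) :
  sigma != 0 -> 0 < sin_sqr_mean sigma.
Proof.
move=> s0.
have [//|le0] := ltP 0 (sin_sqr_mean sigma).
have m0 : (\int[normal_prob 0 sigma]_t (sin t ^+ 2)%:E = 0)%E.
  apply/eqP; rewrite eq_le sin_sqr_meanE lee_fin le0/= -sin_sqr_meanE.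
  by apply: integral_ge0 => t _; rewrite lee_fin sqr_ge0.
have ms : measurable_fun setT (fun t : measurableTypeR R => (sin t ^+ 2)%:E).
  by apply/measurable_EFinP; exact: measurable_sin_exp.
have := (ae_eq_integral_abs (normal_prob 0 sigma) measurableT ms).1.
have -> : (\int[normal_prob 0 sigma]_(x in setT) `|(sin x ^+ 2)%:E| = 0)%E.
  by rewrite -m0; apply: eq_integral => x _; rewrite gee0_abs// lee_fin sqr_ge0.
move=> /(_ erefl) [Z [mZ Z0 subZ]].
have : (normal_prob 0 sigma `]0%R, pi[%classic = 0)%E.
  apply/eqP; rewrite eq_le measure_ge0 andbT -Z0.
  apply: le_measure; rewrite ?inE// => t/=; rewrite in_itv/= => tpi.
  apply: subZ => /= /(_ I) [] /eqP.
  by rewrite sqrf_eq0 gt_eqF// sin_gt0_pi.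
rewrite /normal_prob => i0.
have mp : measurable_fun (`]0%R, pi[%classic : set (measurableTypeR R))
    (fun x => (normal_pdf 0 sigma x)%:E).
  by apply/measurable_EFinP; apply: measurable_funTS;
     exact: measurable_normal_pdf.
have mI : measurable (`]0%R, pi[%classic : set (measurableTypeR R)) by exact: measurable_itv.
have := (ae_eq_integral_abs lebesgue_measure mI mp).1.
under eq_integral do rewrite gee0_abs ?lee_fin ?normal_pdf_ge0//.
rewrite i0 => /(_ erefl) [Y [mY Y0 subY]].
have : (lebesgue_measure (`]0%R, pi[%classic : set (measurableTypeR R)) <= 0)%E.
  rewrite -Y0; apply: le_measure; rewrite ?inE// => t/= tpi.
  apply: subY => /= /(_ tpi) [] /eqP.
  by rewrite normal_pdfE// gt_eqF// mulr_gt0 ?normal_peak_gt0// expR_gt0.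
by rewrite lebesgue_measure_itv/= lte_fin pi_gt0 oppr0 adde0 lee_fin leNgt pi_gt0.
Qed.

Lemma sin_sqr_mean_ge0 (R : realType) (sigma : R) : 0 <= sin_sqr_mean sigma.
Proof. by apply: fine_ge0; apply: integral_ge0 => t _; rewrite lee_fin sqr_ge0. Qed.

Lemma sin_sqr_mean_le1 (R : realType) (sigma : R) : sin_sqr_mean sigma <= 1.
Proof.
rewrite -lee_fin -sin_sqr_meanE.
rewrite -(integral_probability_cst (normal_prob 0 sigma) 1).
apply: ge0_le_integral => //.
- by move=> t _; rewrite lee_fin sqr_ge0.
- by apply/measurable_EFinP; exact: measurable_sin_exp.
- by move=> t _; rewrite lee_fin (le_trans (ler_norm _))// normr_sin_exp_le1.
Qed.

(** Odd powers of the sine integrate to zero by symmetry, and the square is centred by its mean. *)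
Lemma integral_sin_cubic (R : realType) (sigma c0 c1 c2 c3 : R) :
  sigma != 0 ->
  (\int[normal_prob 0 sigma]_t
     (c0 + (c1 * sin t + c2 * (sin t ^+ 2 - sin_sqr_mean sigma)
            + c3 * sin t ^+ 3))%:E = c0%:E)%E.
Proof.
move=> s0; set m2 := sin_sqr_mean sigma; set nu := normal_prob 0 sigma.
have i1 := integrable_sin_exp sigma 1.
have i2 := integrable_sin_exp sigma 2.
have i3 := integrable_sin_exp sigma 3.
have ic c : nu.-integrable setT (fun t => c%:E).
  exact: finite_measure_integrable_cst.
have iZ n c : nu.-integrable setT (fun t => (c%:E * (sin t ^+ n)%:E)%E).
  by apply: integrableZl => //; exact: integrable_sin_exp.
have m2E : (\int[nu]_t (sin t ^+ 2)%:E = m2%:E)%E by exact: sin_sqr_meanE.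
have odd_sin n : odd n -> (\int[nu]_t (sin t ^+ n)%:E = 0)%E.
  move=> on; apply: (@integral_normal_prob_odd _ _ 1) => //.
  - exact: measurable_sin_exp.
  - exact: normr_sin_exp_le1.
  - by move=> t; rewrite sinN exprNn -signr_odd on expr1 mulN1r.
transitivity (\int[nu]_t ((c0 - c2 * m2)%:E + (c1%:E * (sin t ^+ 1)%:E
   + (c2%:E * (sin t ^+ 2)%:E + c3%:E * (sin t ^+ 3)%:E))))%E.
  apply: eq_integral => t _; rewrite -!EFinM -!EFinD; congr EFin; ring.
rewrite integralD//; last first.
  by apply: integrableD => //; apply: integrableD.
rewrite integralD//; last exact: integrableD.
rewrite integralD//.
rewrite !integralZl// m2E (odd_sin 1%N)// (odd_sin 3%N)// integral_probability_cst.
by rewrite !mule0 add0e adde0 -EFinM -EFinD subrK.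
Qed.

Lemma measurable_sin_cubic (R : realType) (c1 c2 c3 m : R) :
  measurable_fun setT (fun t : measurableTypeR R =>
    c1 * sin t + c2 * (sin t ^+ 2 - m) + c3 * sin t ^+ 3).
Proof.
have ms := @measurable_sin_exp R.
apply: measurable_funD; last by apply: measurable_funM.
apply: measurable_funD; first by apply: measurable_funM => //; exact: (ms 1%N).
by apply: measurable_funM => //; apply: measurable_funB.
Qed.

(** In the expanded square the cross term has mean zero, and the noise is bounded by [K]
    pointwise. *)
Lemma sin_cubic_second_moment (R : realType) (sigma r eps c1 c2 c3 K : R) :
  sigma != 0 -> `|c1| + `|c2| + `|c3| <= K ->
  (\int[normal_prob 0 sigma]_t
    ((r - eps * (c1 * sin t + c2 * (sin t ^+ 2 - sin_sqr_mean sigma)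
            + c3 * sin t ^+ 3)) ^+ 2)%:E <= (r ^+ 2 + (eps * K) ^+ 2)%:E)%E.
Proof.
move=> s0 cK; set m2 := sin_sqr_mean sigma.
(* The bound is written as the integral of itself plus the mean-zero cross term, so that the two
   integrands compare pointwise. *)
rewrite -(integral_sin_cubic (r ^+ 2 + (eps * K) ^+ 2)
   (- 2 * r * eps * c1) (- 2 * r * eps * c2) (- 2 * r * eps * c3) s0).
have mq := measurable_sin_cubic c1 c2 c3 m2.
apply: ge0_le_integral => //.
- by move=> t _; rewrite lee_fin sqr_ge0.
- apply/measurable_EFinP; apply: measurable_funX.
  by apply: measurable_funB => //; apply: measurable_funM.
- apply/measurable_EFinP; apply: measurable_funD => //.
  exact: measurable_sin_cubic.
- move=> t _; rewrite lee_fin -/m2.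
  set q := c1 * sin t + c2 * (sin t ^+ 2 - m2) + c3 * sin t ^+ 3.
  have qK : `|q| <= K.
    apply: le_trans cK; apply: le_trans (ler_normD _ _) _.
    apply: lerD; last by rewrite normrM ler_piMr// normr_sin_exp_le1.
    apply: le_trans (ler_normD _ _) _.
    apply: lerD; first by rewrite normrM ler_piMr// normr_sin_le1.
    rewrite normrM ler_piMr// ler_norml.
    have := sin_sqr_mean_ge0 sigma; have := sin_sqr_mean_le1 sigma.
    have := normr_sin_exp_le1 2 t; rewrite ler_norml -/m2.
    have := sqr_ge0 (sin t); lra.
  have : q ^+ 2 <= K ^+ 2.
    by rewrite -(real_normK (num_real q)) lerXn2r// nnegrE// (le_trans _ qK).
  have := sqr_ge0 eps.
  have -> : r ^+ 2 + (eps * K) ^+ 2 + (- 2 * r * eps * c1 * sin t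
     + - 2 * r * eps * c2 * (sin t ^+ 2 - m2) + - 2 * r * eps * c3 * sin t ^+ 3)
     = r ^+ 2 - 2 * r * eps * q + eps ^+ 2 * K ^+ 2.
    by rewrite /q; ring.
  have -> : (r - eps * q) ^+ 2 = r ^+ 2 - 2 * r * eps * q + eps ^+ 2 * q ^+ 2.
    by ring.
  by move=> e0 qK2; rewrite lerD2l ler_wpM2l.
Qed.

(** * The sigma-algebra of the past and its independence from the next probe *)

Section past.
Context (d : measure_display) (T : measurableType d) (R : realType).
Variables (P : probability T R) (v W : nat -> T -> R).

(* [W] runs one step ahead of [v]: the noise [W k.+1] enters the step that draws
   the probe [v k.+1]. *)
Definition past_cylinders (k : nat) : set (set T) :=
  [set C | exists A B : nat -> set R,
     [/\ forall i, measurable (A i), forall i, measurable (B i) &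
       C = \bigcap_(i in [set i | (i < k.+1)%N]) (v i @^-1` A i)
       `&` \bigcap_(i in [set i | (i < k.+2)%N]) (W i @^-1` B i)]].

(** This is [T] with a smaller sigma-algebra: being determined by the past becomes plain
    measurability of a function on [past k]. *)
Definition past (k : nat) : Type := g_sigma_algebraType (past_cylinders k).
HB.instance Definition _ k := Measurable.on (past k).

Lemma measurable_past_v k i : (i <= k)%N ->
  measurable_fun (setT : set (past k)) (v i).
Proof.
move=> ik _ E mE; rewrite setTI; apply: sub_sigma_algebra.
exists (fun j => if j == i then E else setT), (fun=> setT); split=> //.
  by move=> j; case: ifP.
apply/seteqP; split=> w /=.
  move=> Ew; split=> j //= _; case: eqP => // -> //.
by move=> [H _]; have := H i; rewrite /= eqxx ltnS; exact.
Qed.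

Lemma measurable_past_W k i : (i <= k.+1)%N ->
  measurable_fun (setT : set (past k)) (W i).
Proof.
move=> ik _ E mE; rewrite setTI; apply: sub_sigma_algebra.
exists (fun=> setT), (fun j => if j == i then E else setT); split=> //.
  by move=> j; case: ifP.
apply/seteqP; split=> w /=.
  move=> Ew; split=> j //= _; case: eqP => // -> //.
by move=> [_ H]; have := H i; rewrite /= eqxx ltnS; exact.
Qed.

Lemma past_cylindersI k : setI_closed (past_cylinders k).
Proof.
move=> _ _ [A [B [mA mB ->]]] [A' [B' [mA' mB' ->]]].
exists (fun i => A i `&` A' i), (fun i => B i `&` B' i); split.
- by move=> i; exact: measurableI.
- by move=> i; exact: measurableI.
- by rewrite !bigcapI setIACA.
Qed.

Lemma past_cylindersT k : past_cylinders k setT.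
Proof.
exists (fun=> setT), (fun=> setT); split=> //.
by apply/seteqP; split.
Qed.

Hypotheses (mv : forall k, measurable_fun setT (v k))
           (mW : forall k, measurable_fun setT (W k)).

Lemma past_cylinders_measurable k : past_cylinders k `<=` measurable.
Proof.
move=> _ [A [B [mA mB ->]]]; apply: measurableI.
  apply: bigcap_measurable => [|i _]; first by exists 0%N.
  by rewrite -[X in measurable X]setTI; exact: mv.
apply: bigcap_measurable => [|i _]; first by exists 0%N.
by rewrite -[X in measurable X]setTI; exact: mW.
Qed.

(** The identity into [past k] serves as the state variable when the next probe is averaged out with
    the whole past frozen. *)
Lemma measurable_past_id k : measurable_fun setT (id : T -> past k).
Proof.
move=> _ E mE; rewrite setTI preimage_id.
by apply: (smallest_sub (@sigma_algebra_measurable _ T)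
  (@past_cylinders_measurable k)).
Qed.

Variable sigma : R.
Hypotheses (indv : mutually_independent_seq P v)
  (normv : normal_distributed_seq P v 0 sigma)
  (indvW : independent_seqs P v W).

(** On cylinders, independence of the two sequences splits off the noise and mutual independence
    splits off [v k.+1]; the pi-system argument extends this to the whole past. *)
Lemma past_independent k (E : set (past k)) (B : set R) :
  measurable E -> measurable B ->
  P (E `&` v k.+1 @^-1` B) = (P E * normal_prob 0 sigma B)%E.
Proof.
move=> mE mB; rewrite -(normv k.+1 mB).
apply: (@g_sigma_algebra_independent _ T _ P (past_cylinders k)) => //.
- exact: past_cylinders_measurable.
- exact: past_cylindersI.
- exact: past_cylindersT.
- by rewrite -[X in measurable X]setTI; exact: mv.
move=> _ [A [C [mA mC ->]]].
(* The constraint [D] on [v k.+1] is appended to the cylinder, whose probe indices then match the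
   noise indices below [k.+2], as [independent_seqs] requires. *)
pose A' D := fun i => if i == k.+1 then D else A i.
have mA' D : measurable D -> forall i, measurable (A' D i).
  by move=> mD i; rewrite /A'; case: ifP.
have A'E D : \bigcap_(i in [set i | (i < k.+2)%N]) (v i @^-1` A' D i) =
    \bigcap_(i in [set i | (i < k.+1)%N]) (v i @^-1` A i) `&` v k.+1 @^-1` D.
  apply/seteqP; split=> w /=.
    move=> H; split.
      move=> i /= ik; have := H i (ltnW ik).
      by rewrite /A' /= ltn_eqF.
    by have := H k.+1 (ltnSn _); rewrite /A' /= eqxx.
  move=> [H1 H2] i /=; rewrite ltnS leq_eqVlt /A' => /orP[/eqP ->|ik].
    by rewrite eqxx.
  by rewrite ltn_eqF//; exact: H1.
have PA' D : measurable D ->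
    P (\bigcap_(i in [set i | (i < k.+2)%N]) (v i @^-1` A' D i)) =
    (\prod_(i < k.+1) P (v i @^-1` A i) * P (v k.+1 @^-1` D))%E.
  move=> mD; rewrite indv; last exact: mA'.
  rewrite big_ord_recr/= /A' eqxx; congr (_ * _)%E.
  by apply: eq_bigr => i _; rewrite ltn_eqF.
have key D : measurable D -> P (\bigcap_(i in [set i | (i < k.+1)%N])
      (v i @^-1` A i) `&` \bigcap_(i in [set i | (i < k.+2)%N]) (W i @^-1` C i)
      `&` v k.+1 @^-1` D) =
    ((\prod_(i < k.+1) P (v i @^-1` A i) * P (v k.+1 @^-1` D)) *
     P (\bigcap_(i in [set i | (i < k.+2)%N]) (W i @^-1` C i)))%E.
  by move=> mD; rewrite -PA'// -indvW//; [rewrite A'E setIAC|exact: mA'].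
(* [key] is used with [B], then with [setT] to evaluate the probability of the cylinder alone. *)
rewrite key// -[in RHS](setIT (_ `&` _)) -(preimage_setT (v k.+1)) key//.
by rewrite preimage_setT probability_setT mule1 muleAC.
Qed.

End past.

(** * The error recursion and its stopped square *)

Section es_error.
Context {T : Type} {R : realType}.
Variables (xstar phistar phi2 a sigma eps xhat0 : R) (v W : nat -> T -> R).

Local Notation xhat := (es_xhat (quad_map phistar phi2 xstar) a eps xhat0 v W).

Definition es_rate : R := 1 - eps * (phi2 * a * sin_sqr_mean sigma).

Definition es_error (w : T) (k : nat) : R :=
  xhat w k - xstar - es_rate ^+ k * (xhat0 - xstar).

(* [t] is the value of the probe [v k.+1]; all three noise terms have mean zero
   when [t] is a centred Gaussian. *)
Definition es_error_next (w : T) (k : nat) (t : R) : R :=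
  es_rate * es_error w k - eps *
    ((phistar + W k.+1 w + phi2 / 2 * (xhat w k - xstar) ^+ 2) * sin t
     + phi2 * a * (xhat w k - xstar) * (sin t ^+ 2 - sin_sqr_mean sigma)
     + phi2 / 2 * a ^+ 2 * sin t ^+ 3).

Lemma es_error0 w : es_error w 0 = 0.
Proof. by rewrite /es_error /= expr0 mul1r subrr. Qed.

(** Expanding the quadratic map gives the term [phi2 * a * (xhat - xstar) * sin ^ 2]: the mean of
    [sin ^ 2] is absorbed in [es_rate], and the centred part stays as noise. *)
Lemma es_errorS w k : es_error w k.+1 = es_error_next w k (v k.+1 w).
Proof.
rewrite /es_error_next /es_error /= exprS /es_rate /quad_map.
by field.
Qed.

Variable delta : R.

Fixpoint es_inside (w : T) (k : nat) : bool :=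
  (`|es_error w k| < delta) && (if k is k'.+1 then es_inside w k' else true).

Lemma es_insideP w k :
  reflect (forall j, (j <= k)%N -> `|es_error w j| < delta) (es_inside w k).
Proof.
elim: k => [|k IH] /=; first rewrite andbT.
  by apply: (iffP idP) => [H j|]; [rewrite leqn0 => /eqP ->|exact].
apply: (iffP andP) => [[H1 /IH H2] j|H].
  by rewrite leq_eqVlt ltnS => /orP[/eqP ->//|/H2].
by split; [exact: H|apply/IH => j jk; apply: H; exact: leqW].
Qed.

Definition es_stopped_sqr (w : T) (k : nat) : R :=
  if es_inside w k then es_error w k ^+ 2 else delta ^+ 2.

Lemma es_stopped_sqr_ge0 w k : 0 <= es_stopped_sqr w k.
Proof. by rewrite /es_stopped_sqr; case: ifP; rewrite sqr_ge0. Qed.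

Lemma es_stopped_sqr0 w : 0 < delta -> es_stopped_sqr w 0 = 0.
Proof.
by move=> d0; rewrite /es_stopped_sqr /= es_error0 normr0 d0 expr0n.
Qed.

(** At the exit step the true square is at least [delta ^ 2], so freezing at [delta ^ 2] only lowers
    the value. *)
Lemma es_stopped_sqrS w k : 0 < delta -> es_stopped_sqr w k.+1 <=
  if es_inside w k then es_error_next w k (v k.+1 w) ^+ 2 else delta ^+ 2.
Proof.
move=> d0; rewrite /es_stopped_sqr -es_errorS /=.
case: (es_inside w k); last by rewrite andbF.
rewrite andbT; case: ltP => // H.
by rewrite -(real_normK (num_real (es_error w k.+1))) lerXn2r// nnegrE ltW.
Qed.

(** Bounds the sum of the three noise coefficients while [|xhat - xstar|] is at most
    [|xhat0 - xstar| + delta]. It does not depend on [eps], whence an exit probability of order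
    [eps]. *)
Definition es_error_bound (M : R) : R :=
  `|phistar| + M + phi2 / 2 * (`|xhat0 - xstar| + delta) ^+ 2
  + phi2 * a * (`|xhat0 - xstar| + delta) + phi2 / 2 * a ^+ 2.

(** Before exit, [xhat - xstar] is the contracted initial error plus a term below [delta], so the
    coefficients obey [es_error_bound]; [es_rate <= 1] then removes the factor on the squared
    error. *)
Lemma integral_es_error_next w k M : sigma != 0 -> 0 < phi2 -> 0 < a ->
  0 <= es_rate <= 1 -> `|W k.+1 w| <= M -> es_inside w k ->
  (\int[normal_prob 0 sigma]_t (es_error_next w k t ^+ 2)%:E <=
   (es_error w k ^+ 2 + (eps * es_error_bound M) ^+ 2)%:E)%E.
Proof.
move=> s0 p0 a0 /andP[r0 r1] WM /es_insideP /(_ k (leqnn k)) ek.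
set x := xhat w k - xstar; set B := `|xhat0 - xstar| + delta.
have xB : `|x| <= B.
  have -> : x = es_rate ^+ k * (xhat0 - xstar) + es_error w k.
    by rewrite /es_error addrC subrK.
  apply: le_trans (ler_normD _ _) (lerD _ (ltW ek)).
  by rewrite normrM ler_piMl// normrX exprn_ile1// ger0_norm.
apply: le_trans (sin_cubic_second_moment (K := es_error_bound M) _ _ s0 _) _.
  rewrite -/x /es_error_bound -/B.
  apply: lerD; [apply: lerD|].
  - apply: le_trans (ler_normD _ _) _; apply: lerD.
      by apply: le_trans (ler_normD _ _) _; rewrite lerD2l.
    rewrite normrM normrX (gtr0_norm (divr_gt0 p0 _))// ler_wpM2l//.
      by rewrite divr_ge0 ?ltW.
    by rewrite lerXn2r// nnegrE (le_trans _ xB).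
  - rewrite normrM gtr0_norm ?mulr_gt0// ler_wpM2l// ltW// mulr_gt0//.
  - by rewrite ger0_norm// mulr_ge0 ?sqr_ge0// divr_ge0 ?ltW.
rewrite lee_fin lerD2r exprMn ler_piMl ?sqr_ge0//.
exact: exprn_ile1.
Qed.

End es_error.

(** * Measurability of the iteration in its inputs *)

Section es_error_measurable.
Context (d : measure_display) (T : measurableType d) (R : realType).
Variables (xstar phistar phi2 a sigma eps xhat0 delta : R).
Variables (v W : nat -> T -> R).

Local Notation xhat := (es_xhat (quad_map phistar phi2 xstar) a eps xhat0 v W).
Local Notation error := (es_error xstar phistar phi2 a sigma eps xhat0 v W).

(** Only the inputs up to index [k] are assumed measurable, so that the result applies on [past k]
    as well as on the full space. *)
Lemma measurable_es_xhat k :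
  (forall i, (i <= k)%N -> measurable_fun setT (v i)) ->
  (forall i, (i <= k)%N -> measurable_fun setT (W i)) ->
  measurable_fun setT (fun w => xhat w k).
Proof.
elim: k => [|k IH] mv mW /=; first exact: measurable_cst.
have mk : measurable_fun setT (fun w => xhat w k).
  by apply: IH => i ik; [apply: mv|apply: mW]; exact: leqW.
have ms : measurable_fun setT (fun w => sin (v k.+1 w)).
  by apply: measurableT_comp; [exact: measurable_sin|exact: mv].
apply: measurable_funB => //; apply: measurable_funM.
  exact: measurable_funM.
apply: measurable_funD; last exact: mW.
rewrite /quad_map; apply: measurable_funD => //.
apply: measurable_funM => //; apply: measurable_funX.
apply: measurable_funB => //; apply: measurable_funD => //.
exact: measurable_funM.
Qed.

Lemma measurable_es_error k :
  (forall i, (i <= k)%N -> measurable_fun setT (v i)) ->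
  (forall i, (i <= k)%N -> measurable_fun setT (W i)) ->
  measurable_fun setT (fun w => error w k).
Proof.
move=> mv mW; apply: measurable_funB => //; apply: measurable_funB => //.
exact: measurable_es_xhat.
Qed.

Lemma measurable_es_inside k :
  (forall i, (i <= k)%N -> measurable_fun setT (v i)) ->
  (forall i, (i <= k)%N -> measurable_fun setT (W i)) ->
  measurable_fun setT (fun w =>
    es_inside xstar phistar phi2 a sigma eps xhat0 v W delta w k).
Proof.
elim: k => [|k IH] mv mW /=; apply: measurable_and.
- apply: measurable_fun_ltr => //; apply: measurableT_comp => //.
  exact: (measurable_es_error (k := 0)).
- exact: measurable_cst.
- apply: measurable_fun_ltr => //; apply: measurableT_comp => //.
  exact: (measurable_es_error (k := k.+1)).
- by apply: IH => i ik; [apply: mv|apply: mW]; exact: leqW.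
Qed.

Lemma measurable_es_stopped_sqr k :
  (forall i, (i <= k)%N -> measurable_fun setT (v i)) ->
  (forall i, (i <= k)%N -> measurable_fun setT (W i)) ->
  measurable_fun setT (fun w =>
    es_stopped_sqr xstar phistar phi2 a sigma eps xhat0 v W delta w k).
Proof.
move=> mv mW; apply: measurable_fun_ifT; first exact: measurable_es_inside.
  by apply: measurable_funX; exact: measurable_es_error.
exact: measurable_cst.
Qed.

Lemma measurable_es_error_next k :
  (forall i, (i <= k)%N -> measurable_fun setT (v i)) ->
  (forall i, (i <= k.+1)%N -> measurable_fun setT (W i)) ->
  measurable_fun setT (fun z : T * measurableTypeR R =>
    es_error_next xstar phistar phi2 a sigma eps xhat0 v W z.1 k z.2).
Proof.
move=> mv mW; pose Z := (T * measurableTypeR R)%type.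
have mWk i : (i <= k)%N -> measurable_fun setT (W i).
  by move=> ik; apply: mW; exact: leqW.
have mx : measurable_fun setT (fun z : Z => xhat z.1 k).
  apply: (measurableT_comp (f := fun w => xhat w k)) => //.
  exact: measurable_es_xhat.
have me : measurable_fun setT (fun z : Z => error z.1 k).
  apply: (measurableT_comp (f := fun w => error w k)) => //.
  exact: measurable_es_error.
have mWz : measurable_fun setT (fun z : Z => W k.+1 z.1).
  by apply: (measurableT_comp (f := W k.+1)) => //; exact: mW.
have ms n : measurable_fun setT (fun z : Z => sin z.2 ^+ n).
  apply: (measurableT_comp (f := fun t : measurableTypeR R => sin t ^+ n)) => //.
  exact: measurable_sin_exp.
have mxs : measurable_fun setT (fun z : Z => xhat z.1 k - xstar).
  exact: measurable_funB.
apply: measurable_funB; first exact: measurable_funM.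
apply: measurable_funM => //; apply: measurable_funD; last first.
  exact: measurable_funM.
apply: measurable_funD; apply: measurable_funM.
- apply: measurable_funD; first exact: measurable_funD.
  by apply: measurable_funM => //; exact: measurable_funX.
- exact: (ms 1%N).
- exact: measurable_funM.
- exact: measurable_funB.
Qed.

End es_error_measurable.

(** * Growth of the stopped square and the exit probability *)

Section es_maximal.
Context (d : measure_display) (T : measurableType d) (R : realType).
Variables (P : probability T R).
Variables (xstar phistar phi2 a sigma eps xhat0 delta M : R).
Variables (v W : nat -> T -> R).
Hypotheses (phi2_gt0 : 0 < phi2) (a_gt0 : 0 < a) (sigma_gt0 : 0 < sigma)
  (delta_gt0 : 0 < delta) (rate01 : 0 <= es_rate phi2 a sigma eps <= 1).
Hypotheses (iid_v : iid_normal P v sigma)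
  (mW : forall k, measurable_fun setT (W k))
  (W_bounded : forall k w, `|W k w| <= M) (indvW : independent_seqs P v W).

Local Notation inside :=
  (es_inside xstar phistar phi2 a sigma eps xhat0 v W delta).
Local Notation Z :=
  (es_stopped_sqr xstar phistar phi2 a sigma eps xhat0 v W delta).
Local Notation K := (es_error_bound xstar phistar phi2 a xhat0 delta M).

(* The next probe v_{k+1} is independent of the past, so that it is averaged
   out of the square of the next error before the past is. *)
Lemma integral_es_stopped_sqrS k :
  (\int[P]_w (Z w k.+1)%:E <= \int[P]_w (Z w k)%:E + ((eps * K) ^+ 2)%:E)%E.
Proof.
have [mv [indv normv]] := iid_v.
have s0 : sigma != 0 by rewrite gt_eqF.
pose F (z : past v W k * measurableTypeR R) : \bar R :=
  (if inside z.1 k then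
     es_error_next xstar phistar phi2 a sigma eps xhat0 v W z.1 k z.2 ^+ 2
   else delta ^+ 2)%:E.
have mpv i : (i <= k)%N -> measurable_fun setT (v i : past v W k -> R).
  exact: measurable_past_v.
have mpW i : (i <= k.+1)%N -> measurable_fun setT (W i : past v W k -> R).
  exact: measurable_past_W.
have mF : measurable_fun setT F.
  apply/measurable_EFinP; apply: measurable_fun_ifT.
  - apply: (measurableT_comp (f := fun w : past v W k => inside w k)) => //.
    apply: (@measurable_es_inside _ (past v W k)) => // i ik.
    by apply: mpW; exact: leqW.
  - apply: measurable_funX.
    exact: (@measurable_es_error_next _ (past v W k)).
  - exact: measurable_cst.
have F0 z : (0 <= F z)%E by rewrite /F lee_fin; case: ifP; rewrite sqr_ge0.
have mid : measurable_fun setT (id : T -> past v W k).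
  exact: measurable_past_id.
have mvk : measurable_fun setT (v k.+1 : T -> measurableTypeR R) by exact: mv.
have mZ j : measurable_fun setT (fun w => (Z w j)%:E).
  by apply/measurable_EFinP; apply: measurable_es_stopped_sqr.
have indF := @ge0_integral_independent _ _ _ T (past v W k) (measurableTypeR R)
  R P id (v k.+1) (normal_prob 0 sigma) F mid mvk (fun A B mA mB =>
    past_independent mv mW indv normv indvW mA mB) mF F0.
apply: (@le_trans _ _ (\int[P]_w F (w, v k.+1 w))%E).
  apply: ge0_le_integral => //.
  - by move=> w _; rewrite lee_fin es_stopped_sqr_ge0.
  - apply: (measurableT_comp (f := F)) => //.
    exact: (measurable_fun_pair mid mvk).
  - by move=> w _; rewrite lee_fin; exact: es_stopped_sqrS.
rewrite indF.
apply: (@le_trans _ _ (\int[P]_w ((Z w k)%:E + ((eps * K) ^+ 2)%:E))%E).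
  apply: ge0_le_integral => //.
  - by move=> w _; exact: integral_ge0.
  - apply: (measurableT_comp
      (f := fun w : past v W k => (\int[normal_prob 0 sigma]_t F (w, t))%E)) => //.
    exact: measurable_fun_fubini_tonelli_F.
  - by apply: emeasurable_funD => //; exact: mZ.
  - move=> w _; rewrite /F /es_stopped_sqr /=.
    case: ifPn => ins; first exact: integral_es_error_next.
    by rewrite integral_probability_cst lee_fin lerDl sqr_ge0.
rewrite ge0_integralD//.
- by rewrite integral_probability_cst.
- by move=> w _; rewrite lee_fin es_stopped_sqr_ge0.
- by move=> w _; rewrite lee_fin sqr_ge0.
Qed.

Lemma integral_es_stopped_sqr k :
  (\int[P]_w (Z w k)%:E <= (k%:R * (eps * K) ^+ 2)%:E)%E.
Proof.
elim: k => [|k IH].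
  rewrite mul0r integral0_eq// => w _.
  by rewrite es_stopped_sqr0.
apply: le_trans (integral_es_stopped_sqrS k) _.
by rewrite -natr1 mulrDl mul1r EFinD; exact: leeD.
Qed.

Lemma measurable_es_outside k : measurable [set w | ~~ inside w k].
Proof.
have [mv _] := iid_v.
have H : measurable_fun setT (fun w => inside w k).
  by apply: measurable_es_inside.
have := H measurableT [set false] I; rewrite setTI.
by congr measurable; apply/seteqP; split=> w /=; [move=> ->|move/negbTE].
Qed.

(** Markov's inequality. Freezing is permanent, so the stopped square at time [k] equals [delta ^ 2]
    after an exit at any time up to [k]. *)
Lemma es_outside_prob k :
  (P [set w | ~~ inside w k] <= (k%:R * (eps * K) ^+ 2 / delta ^+ 2)%:E)%E.
Proof.
have [mv _] := iid_v.
rewrite EFinM lee_pdivlMr ?exprn_gt0//.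
apply: le_trans (integral_es_stopped_sqr k).
have mS := measurable_es_outside k.
rewrite muleC -integral_cst//.
have mZ D : measurable_fun D (fun w => (Z w k)%:E).
  apply: measurable_funTS; apply/measurable_EFinP.
  by apply: measurable_es_stopped_sqr.
apply: (@le_trans _ _ (\int[P]_(w in [set w | ~~ inside w k]) (Z w k)%:E)%E).
  apply: ge0_le_integral => //.
  - by move=> w _; rewrite lee_fin sqr_ge0.
  - by move=> w /= nins; rewrite lee_fin /es_stopped_sqr (negbTE nins).
apply: ge0_subset_integral => //.
by move=> w _; rewrite lee_fin es_stopped_sqr_ge0.
Qed.

End es_maximal.

(** * Pathwise behaviour as the step size vanishes *)

Lemma es_inside_bound (T : Type) (R : realType)
    (xstar phistar phi2 a sigma eps xhat0 delta : R) (v W : nat -> T -> R)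
    (w : T) (k j : nat) :
  0 <= es_rate phi2 a sigma eps ->
  es_inside xstar phistar phi2 a sigma eps xhat0 v W delta w k -> (j <= k)%N ->
  `|es_xhat (quad_map phistar phi2 xstar) a eps xhat0 v W w j - xstar| <=
  `|xhat0 - xstar| * es_rate phi2 a sigma eps ^+ j + delta.
Proof.
move=> r0 /es_insideP ins /ins /ltW; set x := _ - xstar => ej.
rewrite -(subrK (es_rate phi2 a sigma eps ^+ j * (xhat0 - xstar)) x) addrC.
apply: le_trans (ler_normD _ _) (lerD _ ej).
by rewrite normrM (ger0_norm (exprn_ge0 j r0)) mulrC.
Qed.

Lemma cvg_es_rate (R : realType) (phi2 a sigma : R) :
  es_rate phi2 a sigma eps @[eps --> (0:R)^'+] --> (1 : R).
Proof.
rewrite -[X in _ --> X]subr0 -[X in _ - X](mul0r (phi2 * a * sin_sqr_mean sigma)).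
apply: cvgB; first exact: cvg_cst.
by apply: cvgM; [exact/cvg_at_right_filter/cvg_id|exact: cvg_cst].
Qed.

(** Each increment carries a factor [eps] times a quantity that converges, by induction on [k]. *)
Lemma cvg_es_xhat (T : Type) (R : realType) (xstar phistar phi2 a xhat0 : R)
    (v W : nat -> T -> R) (w : T) (k : nat) :
  es_xhat (quad_map phistar phi2 xstar) a eps xhat0 v W w k
    @[eps --> (0:R)^'+] --> xhat0.
Proof.
elim: k => [|k IH] /=; first exact: cvg_cst.
set s := sin (v k.+1 w).
rewrite -[X in _ --> X]subr0 -[X in _ - X](mul0r (quad_map phistar phi2 xstar
  (xhat0 + a * s) + W k.+1 w)) -[X in _ - X * _](mul0r s).
apply: cvgB => //; apply: cvgM.
  by apply: cvgM; [exact/cvg_at_right_filter/cvg_id|exact: cvg_cst].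
apply: cvgD; last exact: cvg_cst.
apply: cvgD; first exact: cvg_cst.
apply: cvgM; first exact: cvg_cst.
apply: (@cvg_comp _ _ _ _ (fun x : R => x ^+ 2)); last exact: exprn_continuous.
apply: cvgB; last exact: cvg_cst.
by apply: cvgD => //; exact: cvg_cst.
Qed.

Lemma cvg_es_error (T : Type) (R : realType)
    (xstar phistar phi2 a sigma xhat0 : R) (v W : nat -> T -> R) (w : T)
    (k : nat) :
  es_error xstar phistar phi2 a sigma eps xhat0 v W w k
    @[eps --> (0:R)^'+] --> (0 : R).
Proof.
rewrite -[X in _ --> X](subrr (xhat0 - xstar)).
rewrite -[X in _ - X]mul1r -(expr1n R k).
apply: cvgB.
  by apply: cvgB; [exact: cvg_es_xhat|exact: cvg_cst].
apply: cvgM; last exact: cvg_cst.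
apply: (@cvg_comp _ _ _ _ (fun x : R => x ^+ k)); last exact: exprn_continuous.
exact: cvg_es_rate.
Qed.

Lemma near_es_inside (T : Type) (R : realType)
    (xstar phistar phi2 a sigma xhat0 delta : R) (v W : nat -> T -> R) (w : T)
    (k : nat) : 0 < delta ->
  \forall eps \near (0:R)^'+,
    es_inside xstar phistar phi2 a sigma eps xhat0 v W delta w k.
Proof.
move=> d0; have H j : \forall eps \near (0:R)^'+,
    `|es_error xstar phistar phi2 a sigma eps xhat0 v W w j| < delta.
  have /cvgr0Pnorm_lt := cvg_es_error xstar phistar phi2 a sigma xhat0 v W w j.
  exact.
elim: k => [|k IH] /=; near=> eps; apply/andP; split=> //; near: eps => //;
  exact: H.
Unshelve. all: by end_near. Qed.

Theorem theorem10 (d : measure_display) (T : measurableType d) (R : realType)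
  (P : probability T R) (xstar phistar phi2 a sigma eps0 M : R)
  (v W : nat -> T -> R) (nu : probability R R) :
  measure_is_complete P ->
  0 < phi2 -> 0 < a -> 0 < sigma -> 0 < eps0 ->
  iid_normal P v sigma ->
  (forall k, measurable_fun setT (W k)) ->
  ergodic_seq P W nu ->
  (forall k w, `|W k w| <= M) ->
  independent_seqs P v W ->
  exists c gamma : R -> R,
    (forall eps, 0 < eps < eps0 -> 0 < c eps /\ 0 < gamma eps < 1) /\
    forall xhat0 delta : R, 0 < delta ->
      let xt := fun eps w k =>
        es_xhat (quad_map phistar phi2 xstar) a eps xhat0 v W w k - xstar in
      let bound := fun eps (k : nat) =>
        c eps * `|xhat0 - xstar| * gamma eps ^+ k + delta in
      {ae P, forall w,
        (fun eps => first_index (R := R) (fun k => `|xt eps w k| > bound eps k))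
          @ (0:R)^'+ --> +oo%E} /\
      (forall N : nat,
        (fun eps => fine (P [set w | forall k : nat,
              (k <= `|Num.floor (N%:R / eps)|)%N ->
              `|xt eps w k| <= bound eps k]))
          @ (0:R)^'+ --> (1 : R)).
Proof.
move=> _ p0 a0 s0 _ iid mW _ WM indvW.
set lam := phi2 * a * sin_sqr_mean sigma.
have lam0 : 0 < lam by rewrite !mulr_gt0// sin_sqr_mean_gt0// gt_eqF.
pose rate := es_rate phi2 a sigma.
(* As [eps0] is arbitrary, the rate may be nonpositive for large [eps]; the maximum with one half
   keeps [gamma] in []0, 1[], and equals the rate for small [eps]. *)
exists (fun=> 1), (fun eps => Num.max 2^-1 (rate eps)); split.
  move=> eps /andP[e0 _]; split=> //.
  rewrite lt_max gt_max invr_gt0 ltr0n/= invf_lt1// ltr1n/=.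
  by rewrite /rate /es_rate ltrBlDr ltrDl mulr_gt0.
move=> xhat0 delta d0 /=.
have near_rate : \forall eps \near (0:R)^'+, 2^-1 <= rate eps <= 1.
  near=> eps; apply/andP; split.
    near: eps; apply: (cvgr_ge _ (cvg_es_rate phi2 a sigma)).
    by rewrite invf_lt1// ltr1n.
  by rewrite /rate /es_rate lerBlDr lerDl mulr_ge0// ltW.
have rate_ge0 eps : 2^-1 <= rate eps -> 0 <= rate eps.
  by apply: le_trans; rewrite invr_ge0.
split.
  (* The limit holds at every sample point. *)
  apply: aeW => w; apply/cvgeyPge => A.
  (* Since [A < n + 1], it suffices to exclude violations at the finitely many indices up to [n]. *)
  pose n := Num.trunc A.
  near=> eps.
  have /andP[r2 r1] : 2^-1 <= rate eps <= 1 by near: eps.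
  have ins : es_inside xstar phistar phi2 a sigma eps xhat0 v W delta w n.
    by near: eps; exact: near_es_inside.
  apply: le_ereal_inf_tmp => _ [k /= kbad <-]; rewrite lee_fin.
  have [kn|] := leqP k n; last first.
    by move=> nk; rewrite (le_trans (ltW (truncnS_gt A)))// ler_nat.
  move: kbad; rewrite ltNge mul1r (max_idPr r2).
  by rewrite (es_inside_bound (rate_ge0 _ r2) ins kn).
move=> N.
set K := es_error_bound xstar phistar phi2 a xhat0 delta M.
(* The horizon is at most [N / eps], so the exit bound [n * (eps * K) ^ 2 / delta ^ 2] is at most
   [eps * C]. *)
pose C := N%:R * K ^+ 2 / delta ^+ 2.
apply: (@squeeze_cvgr _ _ _ _ (fun eps => 1 - eps * C) (fun=> 1)); last 2 first.
- rewrite -[X in _ --> X]subr0 -[X in _ - X](mul0r C).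
  apply: cvgB; first exact: cvg_cst.
  by apply: cvgM; [exact/cvg_at_right_filter/cvg_id|exact: cvg_cst].
- exact: cvg_cst.
near=> eps.
have e0 : 0 < eps by [].
have /andP[r2 r1] : 2^-1 <= rate eps <= 1 by near: eps.
set n := `|Num.floor (N%:R / eps)|%N.
set E := [set w | _].
have nN : n%:R <= N%:R / eps.
  have NE0 : 0 <= N%:R / eps by rewrite divr_ge0// ltW.
  by rewrite /n natr_absz ger0_norm ?floor_ge0// floor_le.
have [mv _] := iid.
have mE : measurable E.
  (* A countable intersection of measurable events, vacuous beyond the horizon [n]. *)
  have -> : E = \bigcap_k [set w | (k <= n)%N -> `|es_xhat
      (quad_map phistar phi2 xstar) a eps xhat0 v W w k - xstar| <=
      1 * `|xhat0 - xstar| * Num.max 2^-1 (rate eps) ^+ k + delta].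
    by apply/seteqP; split=> w Ew k; [move=> _; exact: Ew|exact: (Ew k I)].
  apply: bigcapT_measurable => k; have [kn|kn] := leqP k n; last first.
    rewrite [X in measurable X](_ : _ = setT)//.
    by apply/seteqP; split=> w //= _.
  have mx : measurable_fun setT (fun w => `|es_xhat
      (quad_map phistar phi2 xstar) a eps xhat0 v W w k - xstar|).
    apply: measurableT_comp => //; apply: measurable_funB => //.
    exact: measurable_es_xhat.
  have mle := measurable_fun_ler mx (measurable_cst
    (1 * `|xhat0 - xstar| * Num.max 2^-1 (rate eps) ^+ k + delta)).
  have := mle measurableT [set true] I; rewrite setTI.
  by congr measurable; apply/seteqP; split=> w /=; [move=> ? _|exact].
have PE1 : (P E <= 1)%E by exact: probability_le1.
have PEfin : P E \is a fin_num by exact: fin_num_measure.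
rewrite -lee_fin -[X in _ && X]lee_fin fineK// PE1 andbT.
have rate01 : 0 <= es_rate phi2 a sigma eps <= 1 by rewrite r1 rate_ge0.
have out := es_outside_prob xstar phistar xhat0 p0 a0 s0 d0 rate01 iid mW WM indvW n.
set O := [set w | _] in out.
have mO : measurable O.
  exact: (measurable_es_outside xstar phistar phi2 a eps xhat0 delta iid mW n).
have subE : ~` O `<=` E.
  move=> w /negP; rewrite negbK => ins k kn.
  rewrite mul1r (max_idPr r2).
  exact: (es_inside_bound (rate_ge0 _ r2) ins kn).
have : (P (~` O) <= P E)%E by apply: le_measure; rewrite ?inE//; exact: measurableC.
apply: le_trans; rewrite probability_setC// EFinB leeB//.
apply: le_trans out _; rewrite lee_fin -/K.
have -> : eps * C = N%:R * eps * (K ^+ 2 / delta ^+ 2) by rewrite /C; ring.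
have -> : n%:R * (eps * K) ^+ 2 / delta ^+ 2 =
    n%:R * eps * eps * (K ^+ 2 / delta ^+ 2) by ring.
rewrite ler_wpM2r ?divr_ge0 ?sqr_ge0//.
by rewrite (ler_wpM2r (ltW e0))// -ler_pdivlMr.
Unshelve. all: by end_near. Qed.
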